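(* Let $n$ and $k$ be integers with $0\le k\le n-2$, and suppose $\frac{k}{n}=\frac{l}{l+1}$ for some integer $l\geq 0$. Then the homology classes $\alpha_0,\dots,\alpha_{n-k-2}$ form a basis of the group $\widetilde{H}_{2l}(\mathcal{N}(n,k))=\mathbb{Z}^{n-k-1}$. Moreover $\sum_{i=0}^{n-k-1}\alpha_{i}=0$.
   Context: All homology has integer coefficients. For integers $i\le j$, $[i,j]_n$ is the image of $\{i,\dots,j\}$ under $\mathbb{Z}\to\mathbb{Z}/n$, and $\mathcal{N}(n,k)$ is the simplicial complex with vertex set $\{0,\dots,n-1\}$ (identified with $\mathbb{Z}/n$) whose maximal simplices are the sets $[i,i+k]_n$, $i=0,\dots,n-1$. When $\frac{k}{n}=\frac{l}{l+1}$ (so $l(n-k)=k$ and $(l+1)(n-k)=n$), let $\Delta$ be the oriented $(2l+1)$-simplex \[\Delta=[0,1,\,n-k,\,n-k+1,\,2(n-k),\,2(n-k)+1,\dots,l(n-k),\,l(n-k)+1].\] It is a minimal non-face of $\mathcal{N}(n,k)$, so its boundary \[\partial\Delta=\sum_{i=0}^l\bigl(\Delta\setminus\{i(n-k)\}-\Delta\setminus\{i(n-k)+1\}\bigr)\] is a $2l$-cycle in $\mathcal{N}(n,k)$ (here $\Delta\setminus\{v\}$ denotes the oriented simplex obtained by deleting $v$ from the ordered list). Let $g$ be the automorphism of $\mathcal{N}(n,k)$ given on vertices by $i\mapsto (i+1)\bmod n$, and for $i\in\mathbb{Z}$ let $\alpha_i=[g^i(\partial\Delta)]\in H_{2l}(\mathcal{N}(n,k))$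 (a class in reduced homology). *)

(* Defs.v *)
From HB Require Import structures.
From mathcomp Require Import all_boot all_order all_algebra.
From mathcomp Require Import ring_quotient.
From mathcomp Require Import boolp.

Set Implicit Arguments.
Unset Strict Implicit.
Unset Printing Implicit Defensive.

Import GRing.Theory.
Local Open Scope ring_scope.
Local Open Scope quotient_scope.

(* A simplicial complex with vertices in 'I_m is given by its set K of faces,
   with set0 a face.  Chains of all degrees live in the single group [chain m]:
   the basis element indexed by A : {set 'I_m} is the simplex A oriented by
   the increasing order of its vertices, and set0 spans degree -1, so that the
   homology below is the reduced one. *)
Notation chain m := {ffun {set 'I_m} -> int}.

Fixpoint inversions (m : nat) (s : seq 'I_m) : nat :=
  if s is x :: s' then (count (fun y : 'I_m => (y < x)%N) s' + inversions s')%N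
  else 0%N.

(* The oriented simplex [v_0, ..., v_d]; it is 0 when a vertex is repeated. *)
Definition osimplex (m : nat) (s : seq 'I_m) : chain m :=
  [ffun A => if uniq s && (A == [set x in s]) then (-1) ^+ inversions s else 0].

Definition del (m : nat) (s : seq 'I_m) (i : nat) : seq 'I_m :=
  take i s ++ drop i.+1 s.

(* The enumeration of a set of ordinals is increasing. *)
Definition boundary (m : nat) (c : chain m) : chain m :=
  \sum_(A : {set 'I_m})
     (\sum_(i < #|A|) osimplex (del (enum A) i) *~ (-1) ^+ i) *~ c A.

(* The chain map induced by a simplicial map; collapsed simplices go to 0. *)
Definition push (m p : nat) (f : 'I_m -> 'I_p) (c : chain m) : chain p :=
  \sum_(A : {set 'I_m}) osimplex (map f (enum A)) *~ c A.

Definition is_chain (m : nat) (K : {set {set 'I_m}}) (d : nat) (c : chain m) :=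
  [forall A, (c A != 0) ==> (A \in K) && (#|A| == d.+1)].

Definition is_cycle (m : nat) (K : {set {set 'I_m}}) (d : nat) : {pred chain m} :=
  fun c => is_chain K d c && (boundary c == 0).

Lemma is_chainP m (K : {set {set 'I_m}}) d (c : chain m) :
  reflect (forall A, ~~ ((A \in K) && (#|A| == d.+1)) -> c A = 0)
          (is_chain K d c).
Proof.
apply: (iffP forallP) => h A.
  by move=> nA; apply/eqP; apply: contraNT nA => cA; apply: implyP (h A) cA.
by apply/implyP; apply: contraNT => /h ->.
Qed.

Lemma is_chain0 m (K : {set {set 'I_m}}) d : is_chain K d 0.
Proof. by apply/is_chainP => A _; rewrite ffunE. Qed.

Lemma is_chainB m (K : {set {set 'I_m}}) d c1 c2 :
  is_chain K d c1 -> is_chain K d c2 -> is_chain K d (c1 - c2).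
Proof.
move=> /is_chainP h1 /is_chainP h2; apply/is_chainP => A nA.
by rewrite !ffunE h1 // h2 // subr0.
Qed.

Lemma boundary0 m : boundary (0 : chain m) = 0.
Proof. by rewrite /boundary big1 // => A _; rewrite ffunE mulr0z. Qed.

Lemma boundaryB m (c1 c2 : chain m) :
  boundary (c1 - c2) = boundary c1 - boundary c2.
Proof.
by rewrite /boundary -sumrB; apply: eq_bigr => A _; rewrite !ffunE mulrzBr.
Qed.

Lemma is_cycle_zmod_closed m (K : {set {set 'I_m}}) d :
  zmod_closed (is_cycle K d).
Proof.
split=> [|c1 c2]; rewrite !unfold_in.
  by rewrite is_chain0 boundary0 eqxx.
move=> /andP[h1 /eqP b1] /andP[h2 /eqP b2].
by rewrite is_chainB //= boundaryB b1 b2 subrr.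
Qed.

HB.instance Definition _ m K d :=
  GRing.isZmodClosed.Build (chain m) (@is_cycle m K d)
    (is_cycle_zmod_closed K d).

Record cycles (m : nat) (K : {set {set 'I_m}}) (d : nat) :=
  Cycle { cycle_val : chain m; _ : cycle_val \in is_cycle K d }.
HB.instance Definition _ m K d := [isSub for @cycle_val m K d].
HB.instance Definition _ m K d := [Choice of @cycles m K d by <:].
HB.instance Definition _ m K d :=
  [SubChoice_isSubZmodule of @cycles m K d by <:].

Definition is_boundary (m : nat) (K : {set {set 'I_m}}) (d : nat) :
    {pred cycles K d} :=
  fun z => `[< exists2 e : chain m, is_chain K d.+1 e & val z = boundary e >].

Lemma is_boundary_zmod_closed m (K : {set {set 'I_m}}) d :
  zmod_closed (@is_boundary m K d).
Proof.
split=> [|z1 z2]; rewrite !unfold_in.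
  by apply/asboolP; exists 0; rewrite ?is_chain0 // boundary0; apply: raddf0.
move=> /asboolP[e1 h1 b1] /asboolP[e2 h2 b2]; apply/asboolP.
by exists (e1 - e2); rewrite ?is_chainB // boundaryB -b1 -b2; apply: raddfB.
Qed.

HB.instance Definition _ m K d :=
  GRing.isZmodClosed.Build (cycles K d) (@is_boundary m K d)
    (is_boundary_zmod_closed K d).

Definition homology (m : nat) (K : {set {set 'I_m}}) (d : nat) : zmodType :=
  Quotient.quot (@is_boundary m K d).

(* The homology class of the cycle c (the junk value 0 if c is not a cycle). *)
Definition hclass (m : nat) (K : {set {set 'I_m}}) (d : nat) (c : chain m) :
    homology K d :=
  \pi_(Quotient.quot (@is_boundary m K d)) (insubd 0 c).

Definition is_Zbasis (V : zmodType) (I : finType) (b : I -> V) : Prop :=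
  forall x : V, exists! a : {ffun I -> int}, x = \sum_i b i *~ a i.

(* 'Z_n is Z/n because n >= 2 throughout. *)
Definition arc (n i j : nat) : {set 'Z_n} :=
  [set x in [seq (a%:R : 'Z_n) | a <- index_iota i j.+1]].

(* The faces of N(n,k) are the subsets of its maximal simplices [i, i+k]_n. *)
Definition NN (n k : nat) : {set {set 'Z_n}} :=
  [set A : {set 'Z_n} | [exists i : 'I_n, A \subset arc n i (i + k)]].

Definition Delta (n k l : nat) : seq 'Z_n :=
  flatten [seq [:: ((i * (n - k))%N%:R : 'Z_n); (i * (n - k) + 1)%N%:R]
          | i <- iota 0 l.+1].

Definition bdDelta (n k l : nat) : chain (Zp_trunc n).+2 :=
  \sum_(i < l.+1)
     (osimplex (rem ((i * (n - k))%N%:R : 'Z_n) (Delta n k l))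
      - osimplex (rem ((i * (n - k) + 1)%N%:R : 'Z_n) (Delta n k l))).

Definition g (n : nat) (x : 'Z_n) : 'Z_n := x + 1.

Definition alpha (n k l i : nat) : homology (NN n k) (2 * l) :=
  hclass (NN n k) (2 * l) (push (iter i (@g n)) (bdDelta n k l)).

(* Main.v *)
From HB Require Import structures.
Require Import Defs.
From mathcomp Require Import all_boot all_order all_algebra.
From mathcomp Require Import ring_quotient boolp.
From mathcomp Require Import zify.
Import GRing.Theory.
Local Open Scope ring_scope.

Set Implicit Arguments.
Unset Strict Implicit.
Unset Printing Implicit Defensive.

(** Write m = n - k, so that n = (l+1)m and k = lm.  A set of vertices is a
    face of N(n,k) exactly when it misses m-1 cyclically consecutive vertices.
    The vertex set of g^a(Delta) is [rot_Delta a], the set of all vertices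
    congruent to a or a+1 modulo m; any two consecutive gaps of it add up to m,
    so that it is not a face although all its facets are.

    The homology is bounded from above by an acyclic matching in the sense of
    discrete Morse theory.  Adjoin to N(n,k) the simplices [rot_Delta a] for
    0 < a < m.  Then every face A is paired with the simplex obtained by adding
    or removing the vertex [pivot A], and the pairing is acyclic with respect to
    [rank] ([pivot_del], [pivot_facet], [matched_face]).  Such a pairing lets
    one fill every cycle ([matching_fill]): each 2l-cycle z of N(n,k) is the
    boundary of a chain e whose simplices are faces or sets [rot_Delta a] with
    0 < a < m.

    It is bounded from below by m-1 explicit cocycles.  For 0 < s < m cut
    {0, ..., n-1} into 2l+2 consecutive blocks of lengths s, m-s, s, m-s, and so
    on, and let [detect] add up the coefficients of a chain at the simplices
    with one vertex in each block but the first.  On a boundary, [detect] adds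
    up the coefficients of e at the transversals of the blocks
    ([detect_boundary]).  Two consecutive blocks have m vertices, so a
    transversal leaves no room for a gap of m and is never a face
    ([face_not_transversal]); hence [detect] is defined on homology classes.
    Moreover [rot_Delta a] is a transversal if and only if a+1 = s or a+1 = m
    ([transversal_rot_Delta]).

    The two bounds meet.  Applied to z = boundary e, the case s = 1 gives the
    coefficient of e at [rot_Delta (m-1)], and then s = a+1 gives the one at
    [rot_Delta a]; if all values vanish, then e is a chain of N(n,k) and z is a
    boundary ([detect_inj]).  So the m-1 cocycles embed the homology into
    Z^(m-1).  They send alpha_0, ..., alpha_(m-2) to the standard basis, and
    alpha_(m-1) to (-1, ..., -1): rotating Delta by m-1 moves its last vertex to
    0, and the resulting cyclic shift of an even number of vertices is odd
    ([coords_alpha]).  Both claims follow. *)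

(** * Oriented simplices and the boundary formula *)

Definition sortedo p (s : seq 'I_p) := sorted (fun x y : 'I_p => (x < y)%N) s.

Lemma sorted_enum p (A : {set 'I_p}) : sortedo (enum A).
Proof.
apply: sorted_filter => [x y z|]; first exact: ltn_trans.
by have := iota_ltn_sorted 0 p; rewrite -val_enum_ord sorted_map enumT.
Qed.

Lemma sortedo_uniq p (s : seq 'I_p) : sortedo s -> uniq s.
Proof.
by apply: sorted_uniq => [x y z|x]; [exact: ltn_trans | rewrite ltnn].
Qed.

Lemma enum_sorted p (s : seq 'I_p) (A : {set 'I_p}) :
  sortedo s -> s =i A -> enum A = s.
Proof.
move=> hs hA; apply: (@irr_sorted_eq _ (fun x y : 'I_p => (x < y)%N)).
- by move=> x y z; exact: ltn_trans.
- by move=> x; rewrite ltnn.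
- exact: sorted_enum.
- exact: hs.
- by move=> x; rewrite mem_enum hA.
Qed.

Lemma sortedo_cons p (x : 'I_p) s :
  sortedo (x :: s) = all (fun y : 'I_p => (x < y)%N) s && sortedo s.
Proof. by apply: path_sortedE => y z t; exact: ltn_trans. Qed.

Lemma inversions_sorted p (s : seq 'I_p) : sortedo s -> inversions s = 0%N.
Proof.
elim: s => // x s IH; rewrite sortedo_cons.
case/andP=> hx hs; rewrite /= IH // addn0; apply/eqP; rewrite -leqn0 leqNgt -has_count.
by apply/hasPn => y /(allP hx); rewrite -leqNgt => /ltnW.
Qed.

Lemma osimplex_sorted p (s : seq 'I_p) (A : {set 'I_p}) :
  sortedo s -> osimplex s A = (enum A == s)%:R.
Proof.
move=> hs; rewrite ffunE sortedo_uniq //= inversions_sorted // expr0.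
case: eqP => [->|nA]; case: eqP => // hA.
- by case: hA; apply: enum_sorted => // x; rewrite inE.
- by case: nA; apply/setP => x; rewrite inE -hA mem_enum.
Qed.

Lemma del_subseq p (s : seq 'I_p) i : subseq (del s i) s.
Proof.
rewrite -[X in subseq _ X](cat_take_drop i) cat_subseq // -add1n -drop_drop.
by rewrite -[X in subseq _ X](cat_take_drop 1 (drop i s)) suffix_subseq.
Qed.

Lemma sorted_del p (s : seq 'I_p) i : sortedo s -> sortedo (del s i).
Proof.
apply: subseq_sorted (del_subseq s i) => x y z; exact: ltn_trans.
Qed.

Lemma del_index p (s : seq 'I_p) x : del s (index x s) = rem x s.
Proof.
rewrite /del; elim: s => //= y s IH.
by case: ifP => _ /=; [rewrite drop0 | rewrite IH].
Qed.

(** The position that [v] has, or would have, in the increasing enumeration of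
    [A]; it gives the sign of the facet opposite to [v]. *)
Definition rank_in p (A : {set 'I_p}) (v : 'I_p) := #|[set u in A | (u < v)%N]|.

Lemma index_enum_rank p (A : {set 'I_p}) v :
  v \in A -> index v (enum A) = rank_in A v.
Proof.
rewrite /rank_in cardE.
have -> : enum [set u in A | (u < v)%N] = [seq u : 'I_p <- enum A | (u < v)%N].
  apply: enum_sorted.
    apply: sorted_filter => [x y z|]; [exact: ltn_trans | exact: sorted_enum].
  by move=> x; rewrite mem_filter mem_enum inE andbC.
rewrite -mem_enum size_filter; elim: (enum A) (sorted_enum A) => // x s IH.
rewrite sortedo_cons inE /= => /andP[/allP hx hs].
case: (eqVneq x v) => [<- _|nxv /= vs].
  rewrite ltnn add0n; apply/esym/eqP; rewrite -leqn0 leqNgt -has_count.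
  by apply/hasPn => y /hx; rewrite -leqNgt => /ltnW.
by rewrite (hx v vs) IH.
Qed.

Lemma ffunMzE p (c : chain p) (k : int) A : (c *~ k) A = c A * k.
Proof.
have h n : (c *+ n) A = c A *+ n by rewrite ffunMnE.
case: k => n; first by rewrite -pmulrn h -mulr_natr natz.
by rewrite NegzE mulrNz ffunE -pmulrn h mulrN -mulr_natr natz.
Qed.

Lemma boundary_basisE p (A L : {set 'I_p}) :
  (\sum_(i < #|A|) osimplex (del (enum A) i) *~ (-1) ^+ i) L
  = \sum_(v in A) (L == A :\ v)%:R * (-1) ^+ rank_in A v.
Proof.
rewrite sum_ffunE [RHS]big_enum_val /=; apply: eq_bigr => i _.
have iE : index (enum_val i) (enum A) = i.
  by rewrite (enum_val_nth (enum_val i)) index_uniq ?enum_uniq // -cardE.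
rewrite ffunMzE -{1}iE del_index osimplex_sorted; last first.
  by rewrite -del_index sorted_del // sorted_enum.
rewrite -index_enum_rank ?enum_valP // iE; congr (_%:R * _).
congr nat_of_bool; apply/eqP/eqP => [h|->].
  apply/setP=> x; have := mem_enum L x; rewrite h mem_rem_uniq ?enum_uniq //.
  by rewrite !inE mem_enum => <-.
apply: enum_sorted; first by rewrite -del_index sorted_del // sorted_enum.
by move=> x; rewrite mem_rem_uniq ?enum_uniq // !inE mem_enum.
Qed.

(** The transpose of the defining formula: the coefficient at [L] collects the
    cofaces of [L].  In this form a boundary can be evaluated at one simplex. *)
Lemma boundaryE p (c : chain p) L :
  boundary c L = \sum_(v | v \notin L) c (v |: L) * (-1) ^+ rank_in L v.
Proof.
rewrite /boundary sum_ffunE.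
under eq_bigr => A _ do rewrite ffunMzE boundary_basisE mulr_suml.
rewrite (exchange_big_dep predT) //= [RHS]big_mkcond /=; apply: eq_bigr => v _.
case: ifP => [vL|/negbFE vL].
  rewrite (bigD1 (v |: L)) ?setU11 //= big1 ?addr0 => [|A /andP[vA nA]].
    rewrite setU1K // eqxx mul1r mulrC; congr (_ * _ ^+ _).
    apply: eq_card => u; rewrite !inE; case: eqP => // ->.
    by rewrite (negPf vL) ltnn.
  case: eqP => [e|_]; last by rewrite !mul0r.
  by rewrite e setD1K // eqxx in nA.
rewrite big1 // => A vA; case: eqP => [e|_]; last by rewrite !mul0r.
by rewrite e !inE eqxx in vL.
Qed.

(** Adding [v] and [w] to [L] in the two possible orders gives opposite signs,
    because the smaller of the two vertices shifts the position of the other. *)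
Lemma boundary_boundary p (c : chain p) : boundary (boundary c) = 0.
Proof.
apply/ffunP => L; rewrite boundaryE ffunE.
pose F (v w : 'I_p) : int := if [&& v \notin L, w \notin L & v != w] then
  c (w |: (v |: L)) * (-1) ^+ rank_in (v |: L) w * (-1) ^+ rank_in L v else 0.
have FE : \sum_(v | v \notin L) boundary c (v |: L) * (-1) ^+ rank_in L v
          = \sum_v \sum_w F v w.
  rewrite big_mkcond /=; apply: eq_bigr => v _; rewrite /F.
  case: ifP => vL; last by rewrite big1.
  rewrite boundaryE mulr_suml big_mkcond /=; apply: eq_bigr => w _.
  by rewrite !inE negb_or eq_sym andbC.
have FN v w : F v w = - F w v.
  rewrite /F [w == v]eq_sym; case: ifP => [/and3P[vL wL vw]|h]; last first.
    by rewrite andbCA h oppr0.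
  rewrite vL wL vw /= setUCA -!mulrA -mulrN; congr (_ * _).
  have rU x y : x \notin L -> rank_in (x |: L) y = ((x < y)%N + rank_in L y)%N.
    move=> xL; rewrite /rank_in; case: ltnP => xy.
      have -> : [set u in x |: L | (u < y)%N] = x |: [set u in L | (u < y)%N].
        by apply/setP => u; rewrite !inE; case: eqP => // ->; rewrite xy.
      by rewrite cardsU1 inE (negPf xL).
    apply: eq_card => u; rewrite !inE; case: eqP => // ->.
    by rewrite ltnNge xy !andbF.
  rewrite !rU // !exprD.
  have /orP[h|h] : (v < w)%N || (w < v)%N by rewrite -neq_ltn.
    by rewrite h ltnNge (ltnW h) /= expr0 expr1 !mulN1r mul1r mulNr mulrC.
  by rewrite h ltnNge (ltnW h) /= expr0 expr1 !mulN1r mul1r mulNr opprK mulrC.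
rewrite FE; set S := \sum_v _.
have SN : S = - S.
  rewrite {1}/S exchange_big /= -sumrN; apply: eq_bigr => v _.
  by rewrite -sumrN; apply: eq_bigr => w _.
lia.
Qed.

(** * Filling cycles by an acyclic matching *)

Lemma boundaryD p (c1 c2 : chain p) :
  boundary (c1 + c2) = boundary c1 + boundary c2.
Proof.
have bN (c : chain p) : boundary (- c) = - boundary c.
  by rewrite -sub0r boundaryB boundary0 sub0r.
by rewrite -[c2]opprK boundaryB [in RHS]bN.
Qed.

Lemma sum_neq0 (I : finType) (P : pred I) (F : I -> int) :
  \sum_(i | P i) F i != 0 -> exists2 i, P i & F i != 0.
Proof.
move=> h; case: (pickP (fun i => P i && (F i != 0))) => [i /andP[Pi Fi]|h0].
  by exists i.
case/eqP: h; apply: big1 => i Pi; apply/eqP/negbNE.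
by rewrite -[F i != 0]andTb -Pi h0.
Qed.

(** An abstract form of algebraic discrete Morse theory.  Every face [A] is
    paired with the set obtained by toggling [pv A]; it is the lower member of
    its pair when [pv A] lies outside [A].  The upper member of a pair need not
    be a face, and acyclicity is expressed by a rank: every lower facet of an
    upper member, other than its partner, has smaller rank than the partner. *)
Section AcyclicMatching.

Variables (p d : nat) (N : {set {set 'I_p}}).
Variables (pv : {set 'I_p} -> 'I_p) (rk : {set 'I_p} -> nat).
Hypothesis pv_del : forall A, A \in N -> pv A \in A ->
  A :\ pv A \in N /\ pv (A :\ pv A) = pv A.
Hypothesis facet : forall L q, L \in N -> pv L \notin L -> q \in L ->
  (pv L |: L) :\ q \in N /\
  (pv ((pv L |: L) :\ q) \in (pv L |: L) :\ q \/
   (rk ((pv L |: L) :\ q) < rk L)%N).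

Definition matched_cofaces (e : chain p) := forall A : {set 'I_p}, e A != 0 ->
  exists L, [/\ L \in N, pv L \notin L, #|L| = d.+1 & A = pv L |: L].

(** Both steps of the filling argument compare the pair of [L] with an
    arbitrary facet [M] of its upper member. *)
Lemma matched_facet (L M : {set 'I_p}) v : L \in N -> pv L \notin L -> v \notin M ->
  pv L |: L = v |: M -> [/\ M = L & v = pv L] \/
  [/\ M \in N, #|M| = #|L| & (pv M \in M) || (rk M < rk L)%N].
Proof.
move=> LN pL vM e.
have ME : M = (pv L |: L) :\ v by rewrite e setU1K.
case: (eqVneq v (pv L)) => [vE|nv].
  by left; split; rewrite // ME vE setU1K.
right; have vL : v \in L.
  by have := setU11 v M; rewrite -e !inE (negPf nv).
have [hN hr] := facet LN pL vL; rewrite -ME in hN hr; split=> //.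
  by have := congr1 (fun X : {set _} => #|X|) e; rewrite !cardsU1 pL vM => -[].
by case: hr => ->; rewrite ?orbT.
Qed.

(** Subtracting the boundaries of the upper members clears the coefficients of
    the lower simplices of the highest rank present: the other lower facets
    created by this have smaller rank. *)
Lemma matching_reduce r (z : chain p) : is_chain N d z ->
  (forall A, pv A \notin A -> (r <= rk A)%N -> z A = 0) ->
  exists e, [/\ matched_cofaces e, is_chain N d (z - boundary e)
    & forall A, pv A \notin A -> (z - boundary e) A = 0].
Proof.
elim: r z => [|r IH] z zN zr.
  exists 0; rewrite boundary0 subr0; split=> // [A|A pA]; first by rewrite ffunE.
  exact: zr.
pose cond L := (pv L \notin L) && (rk L == r).
pose e0 : chain p := [ffun B => \sum_(L | cond L && (pv L |: L == B))
                         z L * (-1) ^+ rank_in L (pv L)].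
have zNP L : z L != 0 -> L \in N /\ #|L| = d.+1.
  move=> zL; have /is_chainP/(_ L) h := zN.
  case: (boolP ((L \in N) && (#|L| == d.+1))) => [/andP[-> /eqP ->] //|/h z0].
  by rewrite z0 eqxx in zL.
have e0N : is_chain N d (boundary e0).
  apply/is_chainP => M nM; apply/eqP; apply: contraNT nM.
  rewrite boundaryE => /sum_neq0[v vM].
  rewrite ffunE mulf_eq0 negb_or => /andP[/sum_neq0[L /andP[/andP[pL _] /eqP e]]].
  rewrite mulf_eq0 negb_or => /andP[/zNP[LN cL] _] _.
  by case: (matched_facet LN pL vM e) => [[-> _]|[-> -> _]]; rewrite ?LN cL eqxx.
have e0E M : pv M \notin M -> (r <= rk M)%N ->
    boundary e0 M = if rk M == r then z M else 0.
  move=> pM rM.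
  have only v L : v \notin M -> cond L && (pv L |: L == v |: M) -> z L != 0 ->
      M = L /\ v = pv L.
    move=> vM /andP[/andP[pL /eqP rL] /eqP e] /zNP[LN _].
    case: (matched_facet LN pL vM e) => // -[_ _].
    by rewrite (negPf pM) /= rL ltnNge rM.
  rewrite boundaryE; case: ifP => rk_M.
    rewrite (bigD1 (pv M)) //= big1 ?addr0 => [|v /andP[vM nv]]; last first.
      rewrite ffunE big1 ?mul0r // => L hL; apply/eqP.
      rewrite mulf_eq0; apply/orP; left; apply/negbNE/negP => zL.
      by have [eL ev] := only v L vM hL zL; rewrite ev eL eqxx in nv.
    rewrite ffunE (bigD1 M) /= ?/cond ?pM ?rk_M ?eqxx //.
    rewrite big1 ?addr0 => [|L /andP[hL nL]].
      by rewrite -mulrA -expr2 sqrr_sign mulr1.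
    apply/eqP; rewrite mulf_eq0; apply/orP; left; apply/negbNE/negP => zL.
    by have [eL _] := only (pv M) L pM hL zL; rewrite eL eqxx in nL.
  apply: big1 => v vM; rewrite ffunE big1 ?mul0r // => L hL; apply/eqP.
  rewrite mulf_eq0; apply/orP; left; apply/negbNE/negP => zL.
  have [eL _] := only v L vM hL zL.
  by move: hL; rewrite -eL /cond rk_M andbF.
have [|A pA rA|e [eP eN eU]] := IH (z - boundary e0).
- exact: is_chainB.
- rewrite !ffunE e0E //; case: eqP => rE; first by rewrite subrr.
  by rewrite zr // ?subr0 // ltn_neqAle eq_sym; case: eqP.
exists (e0 + e); rewrite boundaryD opprD addrA; split=> // A.
case: (eqVneq (e A) 0) => [eA|/eP //].
rewrite !ffunE eA addr0 => /sum_neq0[L /andP[/andP[pL _] /eqP <-]].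
rewrite mulf_eq0 negb_or => /andP[/zNP[LN cL] _].
by exists L.
Qed.

(** Among the simplices of a cycle of upper members take one whose partner has
    maximal rank.  No other simplex of the cycle contains that partner, so the boundary
    does not vanish there. *)
Lemma matched_cycle_eq0 (z : chain p) : is_chain N d z ->
  (forall A, pv A \notin A -> z A = 0) -> boundary z = 0 -> z = 0.
Proof.
move=> zN zU bz; apply/ffunP => A0; rewrite ffunE; apply/eqP/negbNE/negP => zA0.
case: (@arg_maxnP _ A0 (fun A => z A != 0) (fun A => rk (A :\ pv A)) zA0).
move=> A zA Amax.
have good B : z B != 0 -> pv B \in B /\ B \in N.
  move=> zB; split.
    by apply/negbNE/negP => h; rewrite zU ?eqxx in zB.
  have /is_chainP/(_ B) h := zN; apply/negbNE/negP => nB.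
  by move: zB; rewrite h ?eqxx // (negPf nB).
have [pA AN] := good A zA; have [LN pL] := pv_del AN pA.
move/ffunP/(_ (A :\ pv A)): bz; rewrite boundaryE ffunE.
have pnL : pv A \notin A :\ pv A by rewrite !inE eqxx.
rewrite (bigD1 (pv A)) //= big1 ?addr0 => [|v /andP[vL nv]].
  rewrite setD1K // => /eqP; rewrite mulf_eq0 (negPf zA) /=.
  by rewrite signr_eq0.
apply/eqP; rewrite mulf_eq0; apply/orP; left; apply/negbNE/negP => zB.
set B := v |: _ in zB; have [pB BN] := good B zB.
have [LB pLB] := pv_del BN pB.
have := @matched_facet (B :\ pv B) (A :\ pv A) v LB.
rewrite pLB setD1K // !inE eqxx /= => /(_ isT); rewrite -in_setD1 => /(_ vL erefl).
case=> [[e ev]|[_ _]]; first by case/eqP: nv; rewrite ev -pLB -e.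
by rewrite pL eqxx /= ltnNge => /negP[]; exact: Amax.
Qed.

Lemma matching_fill (z : chain p) : is_chain N d z -> boundary z = 0 ->
  exists2 e, matched_cofaces e & z = boundary e.
Proof.
move=> zN bz.
have [|e [eP eN eU]] := @matching_reduce (\max_A rk A).+1 z zN.
  by move=> A _ h; have := leq_trans h (leq_bigmax A); rewrite ltnn.
exists e => //; apply/eqP; rewrite -subr_eq0; apply/eqP.
apply: matched_cycle_eq0 => //.
by rewrite boundaryB bz boundary_boundary subr0.
Qed.

End AcyclicMatching.

(** * Faces of N(n,k) and their matching *)

Section Faces.

Variables (p m l : nat).
Hypotheses (m_gt1 : (1 < m)%N) (p_def : p.+1 = (l * m + m)%N).
Implicit Types A B L : {set 'I_p.+1}.

(** The vertices u+1, ..., u+m-1 are missed, where u+m is at most n.  In cyclic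
    terms there is a gap that does not have the vertex 0 in its interior, or, in
    other words, adding 0 leaves [A] a face. *)
Definition has_gap A :=
  [exists u : 'I_(l * m).+1, [forall x in A, (x <= u)%N || (u + m <= x)%N]].

(** The second alternative covers the arcs [i, i+k] that do not wrap around and
    avoid 0. *)
Definition face A :=
  has_gap A || [exists i : 'I_m, (0 < i)%N &&
                 [forall x in A, (i <= x <= i + l * m)%N]].

Definition first A : nat :=
  [arg min_(x < odflt ord0 [pick x in A] in A) (x : nat)].

(** The part of a period of length m, counted from [a], that is disjoint from
    [a + j m] and [a + j m + 1]. *)
Definition window A a j :=
  [exists x in A, (a + j * m + 1 < x < a + j * m + m)%N].

(** If [A] is a face without a gap, this is the number of initial periods,
    counted from the first vertex [a], in which [A] follows the pattern a, a+1,
    a+m, a+m+1, ... of [rot_Delta a]. *)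
Definition depth A := find (window A (first A)) (iota 0 l).

Definition pivot_val A := (first A + depth A * m + 1)%N.

(** When there is no gap away from 0, the pivot sits just after the first vertex
    of the period in which the pattern breaks down.  It lies outside all windows,
    so that toggling it does not change the depth.  If the pattern never breaks
    down, the pivot is the one vertex that completes [A] to [rot_Delta a]. *)
Definition pivot A : 'I_p.+1 :=
  if has_gap A then ord0 else inord (pivot_val A %% p.+1).

(** Faces to which 0 can be added come first; the others are ordered
    lexicographically, a later first vertex and then a longer pattern making the
    rank smaller. *)
Definition rank A :=
  if has_gap A then 0%N
  else ((p.+1 - first A) * l.+1 + (l - depth A)).+1.

Definition pair_set (c e : nat) : {set 'I_p.+1} :=
  [set x : 'I_p.+1 | (x %% m == c)%N || (x %% m == e)%N].

(** For a < m these are the vertices congruent to a or a+1 modulo m. *)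
Definition rot_Delta a :=
  if (a.+1 < m)%N then pair_set a a.+1 else pair_set 0 m.-1.

Lemma has_gapI A u : (u <= l * m)%N ->
  (forall x, x \in A -> (x <= u)%N || (u + m <= x)%N) -> has_gap A.
Proof.
rewrite -ltnS => hu h; apply/existsP; exists (Ordinal hu).
by apply/forall_inP => x /h.
Qed.

Lemma no_gap A u : ~~ has_gap A -> (u <= l * m)%N ->
  exists2 x, x \in A & (u < x < u + m)%N.
Proof.
move=> nA hu; apply/exists_inP; apply: contraNT nA => /exists_inPn h.
by apply: (has_gapI hu) => x /h; lia.
Qed.

Lemma has_gapS A B : A \subset B -> has_gap B -> has_gap A.
Proof.
move=> /subsetP sAB /existsP[u /forall_inP h]; apply/existsP; exists u.
by apply/forall_inP => x /sAB /h.
Qed.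

Lemma faceS A B : A \subset B -> face B -> face A.
Proof.
move=> sAB /orP[h|/existsP[i /andP[i0 /forall_inP h]]]; rewrite /face.
  by rewrite (has_gapS sAB).
apply/orP; right; apply/existsP; exists i; rewrite i0.
by apply/forall_inP => x /(subsetP sAB) /h.
Qed.

Lemma firstP A x0 : x0 \in A -> exists2 a : 'I_p.+1, a \in A &
  first A = a /\ forall x, x \in A -> (first A <= x)%N.
Proof.
move=> Ax0; rewrite /first; case: pickP => [y Ay|/(_ x0)]; last by rewrite Ax0.
by case: arg_minnP => //= a Aa h; exists a.
Qed.

Lemma first_eq A (a : 'I_p.+1) : a \in A -> (forall x, x \in A -> (a <= x)%N) ->
  first A = a.
Proof.
move=> aA h; have [b bA [bE hb]] := firstP aA.
by apply/eqP; rewrite eqn_leq hb // bE h.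
Qed.

Lemma depth_le A : (depth A <= l)%N.
Proof. by rewrite -[X in (_ <= X)%N](size_iota 0 l) find_size. Qed.

Lemma window_before A j : (j < depth A)%N -> ~~ window A (first A) j.
Proof.
move=> h; have := before_find 0%N h; rewrite nth_iota ?add0n => [->//|].
exact: leq_trans h (depth_le A).
Qed.

Lemma window_depth A : (depth A < l)%N -> window A (first A) (depth A).
Proof.
move=> h; have := @nth_find _ 0%N (window A (first A)) (iota 0 l).
by rewrite has_find size_iota -/(depth A) nth_iota // add0n; apply.
Qed.

Lemma windowI A a j x : x \in A -> (a + j * m + 1 < x < a + j * m + m)%N ->
  window A a j.
Proof. by move=> xA h; apply/exists_inP; exists x. Qed.

Lemma depth_ge A j : (j <= l)%N ->
  (forall t, (t < j)%N -> ~~ window A (first A) t) -> (j <= depth A)%N.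
Proof.
move=> jl h; rewrite leqNgt; apply/negP => hj.
by have := h _ hj; rewrite window_depth // (leq_trans hj).
Qed.

Lemma mul_lt (t j : nat) : (t < j)%N -> (t * m + m <= j * m)%N.
Proof. by move=> h; rewrite addnC -mulSn leq_mul2r h orbT. Qed.

(** Without a gap away from 0, a face is contained in an arc from its first
    vertex, and that vertex is one of 1, ..., m-1. *)
Lemma rotating_face A : face A -> ~~ has_gap A ->
  [/\ exists2 a : 'I_p.+1, a \in A & first A = a, (0 < first A)%N,
      (first A < m)%N & forall x, x \in A -> (first A <= x <= first A + l * m)%N].
Proof.
move=> fA nA; have := fA; rewrite /face (negPf nA) /=.
case/existsP=> i /andP[i0 /forall_inP hi].
have [x0 x0A x0m] := no_gap nA (leq0n _).
have [a aA [aE ha]] := firstP x0A.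
have := hi a aA; have := ha x0 x0A => h1 h2; split.
- by exists a.
- by lia.
- by lia.
- by move=> x xA; have := hi x xA; have := ha x xA; lia.
Qed.

(** As long as the windows are empty, the absence of gaps forces the next vertex
    of the pattern to be present. *)
Lemma spine A j : face A -> ~~ has_gap A -> (j <= l)%N ->
  (forall t, (t < j)%N -> ~~ window A (first A) t) ->
  (exists2 x : 'I_p.+1, x \in A & x = (first A + j * m)%N :> nat) /\
  (forall t, (t < j)%N ->
     exists2 x : 'I_p.+1, x \in A & x = (first A + t * m + 1)%N :> nat).
Proof.
move=> fA nA; have [[a aA aE] a0 am ha] := rotating_face fA nA.
elim: j => [_ _|j IH jl hw].
  by split=> //; exists a; rewrite // aE mul0n addn0.
have [|[x xA xE] hx] := IH (ltnW jl); first by move=> t /ltnW; exact: hw.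
have jm := mul_lt jl.
have [|y yA yh] := @no_gap A (first A + j * m) nA; first by lia.
have yE : y = (first A + j * m + 1)%N :> nat.
  have := hw j (ltnSn j); case: (ltnP (first A + j * m + 1) y) => hy; last by lia.
  by rewrite (windowI yA) // hy; lia.
have [|z zA zh] := @no_gap A (first A + j * m + 1) nA; first by lia.
have zE : z = (first A + j.+1 * m)%N :> nat.
  have := hw j (ltnSn j); case: (ltnP z (first A + j * m + m)) => hz.
    by rewrite (windowI zA) //; lia.
  by rewrite mulSn; lia.
split; first by exists z.
move=> t; rewrite ltnS leq_eqVlt => /orP[/eqP->|/hx //].
by exists y.
Qed.

Lemma val_pivot A : ~~ has_gap A -> pivot A = (pivot_val A %% p.+1)%N :> nat.
Proof. by move=> nA; rewrite /pivot (negPf nA) inordK // ltn_mod. Qed.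

Lemma window_avoid a j t (x : 'I_p.+1) : x = (a + j * m + 1)%N :> nat ->
  ~~ (a + t * m + 1 < x < a + t * m + m)%N.
Proof.
move=> ->; case: (leqP j t) => h.
  have : (j * m <= t * m)%N by rewrite leq_mul2r h orbT.
  by lia.
by have := mul_lt h; lia.
Qed.

(** Removing the pivot creates no gap: its neighbour below is in the pattern and
    the window above it is occupied. *)
Lemma pivot_del A : face A -> pivot A \in A ->
  face (A :\ pivot A) /\ pivot (A :\ pivot A) = pivot A.
Proof.
move=> fA pA; split; first exact: faceS (subD1set _ _) fA.
case: (boolP (has_gap A)) => gA.
  by rewrite /pivot (has_gapS (subD1set _ _) gA) gA.
have [[a aA aE] a0 am ha] := rotating_face fA gA.
have pE := val_pivot gA.
have dl := depth_le A.
have [jl pvE] : (depth A < l)%N /\ pivot A = pivot_val A :> nat.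
  move: dl; rewrite leq_eqVlt => /orP[/eqP dE|dl].
    move: pE (ha _ pA); rewrite /pivot_val dE => pE.
    case: (ltnP (first A).+1 m) => h.
      by rewrite modn_small in pE; lia.
    by rewrite (_ : (_ + _)%N = p.+1) ?modnn in pE; lia.
  by split=> //; rewrite pE /pivot_val modn_small //; have := mul_lt dl; lia.
have jm := mul_lt jl; rewrite /pivot_val in pvE.
have [[x xA xE] _] := spine fA gA (ltnW jl) (@window_before A).
have /exists_inP[y yA yh] := window_depth jl.
have gA' : ~~ has_gap (A :\ pivot A).
  apply/negP => /existsP[u /forall_inP hu].
  have neq (z : 'I_p.+1) : z \in A -> z != pivot A :> nat -> (z <= u)%N || (u + m <= z)%N.
    by move=> zA nz; apply: hu; rewrite !inE zA andbT; apply: contraNneq nz => ->.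
  have [|z zA zh] := @no_gap A u gA; first by rewrite -ltnS.
  have := neq z zA; have := neq x xA; have := neq y yA; lia.
have fE : first (A :\ pivot A) = first A.
  rewrite aE; apply: first_eq => [|z].
    by rewrite !inE aA andbT -val_eqE /= -aE pvE; lia.
  by rewrite inE => /andP[_ /ha]; lia.
have wE t : window (A :\ pivot A) (first A) t = window A (first A) t.
  apply/exists_inP/exists_inP => -[z zA zh]; exists z => //.
    by move: zA; rewrite inE => /andP[].
  rewrite !inE zA andbT; apply: contraTneq zh => ->.
  exact: window_avoid pvE.
have dE : depth (A :\ pivot A) = depth A by rewrite /depth fE; apply: eq_find.
by rewrite {1 3}/pivot (negPf gA) (negPf gA') /pivot_val fE dE.
Qed.

Lemma full_depth_mem A x : face A -> ~~ has_gap A -> depth A = l -> x \in A ->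
  exists t, (t <= l)%N /\ (x = (first A + t * m)%N :> nat \/
     (t < l)%N /\ x = (first A + t * m + 1)%N :> nat).
Proof.
move=> fA gA dA xA; have [_ _ _ /(_ x xA) hx] := rotating_face fA gA.
have xE := divn_eq (x - first A) m; set t := (_ %/ m)%N in xE.
have rm : ((x - first A) %% m < m)%N by rewrite ltn_mod; lia.
set r := (_ %% m)%N in xE rm.
have tl : (t <= l)%N.
  rewrite leqNgt; apply/negP => /mul_lt; lia.
exists t; split=> //; move: (tl); rewrite leq_eqVlt => /orP[/eqP tE|tl'].
  by left; move: xE hx; rewrite tE; lia.
have /negP nw : ~~ window A (first A) t by rewrite window_before // dA.
case: (ltnP 1 r) => hr; last by lia.
by case: nw; apply: (windowI xA); lia.
Qed.

Lemma full_depth_pivot A : face A -> ~~ has_gap A -> depth A = l ->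
  (((first A).+1 < m)%N /\ pivot A = (first A + l * m + 1)%N :> nat) \/
  (first A = m.-1 /\ pivot A = 0%N :> nat).
Proof.
move=> fA gA dA; have [_ a0 am _] := rotating_face fA gA.
rewrite val_pivot // /pivot_val dA; case: (ltnP (first A).+1 m) => h.
  by left; rewrite modn_small //; lia.
by right; rewrite (_ : (_ + _)%N = p.+1) ?modnn //; lia.
Qed.

Lemma div_le (x : 'I_p.+1) : (x %/ m <= l)%N.
Proof. by rewrite -ltnS ltn_divLR ?mulSn 1?addnC -?p_def //; lia. Qed.

(** The two gaps next to [v] merge into one of length m.  Only when [v] is the
    first or the last vertex can the merged gap contain 0. *)
Lemma pair_set_facet c e v : (c < e < m)%N -> v \in pair_set c e ->
  face (pair_set c e :\ v).
Proof.
move=> ce; have DE x : x \in pair_set c e ->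
    exists2 t, (t <= l)%N & x = (t * m + c)%N :> nat \/ x = (t * m + e)%N :> nat.
  rewrite inE => h; exists (x %/ m)%N; first exact: div_le.
  by case/orP: h => /eqP <-; [left|right]; exact: divn_eq.
have BE x : x \in pair_set c e :\ v -> x != v :> nat /\
    exists2 t, (t <= l)%N & x = (t * m + c)%N :> nat \/ x = (t * m + e)%N :> nat.
  by rewrite in_setD1 => /andP[nx /DE].
case/DE=> j jl [vE|vE].
  case: j => [|j] in jl vE.
    apply/orP; right; have em : (e < m)%N by lia.
    apply/existsP; exists (Ordinal em) => /=; apply/andP; split; first by lia.
    apply/forall_inP => x /BE[nx [t tl xE]].
    have : (t * m <= l * m)%N by rewrite leq_mul2r tl orbT.
    by case: t tl xE => [|t] tl; rewrite ?mulSn; lia.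
  have jm := mul_lt jl; rewrite mulSn in vE.
  apply/orP; left; apply: (@has_gapI _ (j * m + e)); first by lia.
  move=> x /BE[nx [t tl xE]].
  case: (ltngtP t j) => [/mul_lt|jt|tE]; first by lia.
    case: (ltngtP t j.+1) => [||tE]; [lia|move=> /mul_lt; rewrite mulSn; lia|].
    by move: xE; rewrite tE mulSn; lia.
  by move: xE; rewrite tE; lia.
move: jl; rewrite leq_eqVlt => /orP[/eqP jl|jl].
  case: (posnP c) => c0.
    apply/orP; left; apply: (@has_gapI _ (l * m)) => // x /BE[nx [t]].
    rewrite leq_eqVlt => /orP[/eqP tE|/mul_lt tm]; last by lia.
    by rewrite tE; rewrite jl in vE; lia.
  apply/orP; right; have cm : (c < m)%N by lia.
  apply/existsP; exists (Ordinal cm) => /=; apply/andP; split => //.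
  apply/forall_inP => x /BE[nx [t]].
  rewrite leq_eqVlt => /orP[/eqP tE|/mul_lt tm]; last by lia.
  by rewrite tE; rewrite jl in vE; lia.
have jm := mul_lt jl.
apply/orP; left; apply: (@has_gapI _ (j * m + c)); first by lia.
move=> x /BE[nx [t tl xE]].
by case: (ltngtP t j) => [/mul_lt|/mul_lt|tE]; lia.
Qed.

Lemma rot_Delta_facet a v : (a < m)%N -> v \in rot_Delta a -> face (rot_Delta a :\ v).
Proof. by rewrite /rot_Delta => am; case: ifP => h; apply: pair_set_facet; lia. Qed.

(** The upper member of a pair is a face unless the pattern extends over all
    periods, in which case [A] has no further vertices. *)
Lemma matched_face A : face A -> pivot A \notin A ->
  face (pivot A |: A) \/ exists2 a, (0 < a < m)%N & pivot A |: A = rot_Delta a.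
Proof.
move=> fA pA; case: (boolP (has_gap A)) => gA.
  left; apply/orP; left; have /existsP[u /forall_inP hu] := gA.
  apply/existsP; exists u; apply/forall_inP => x.
  by rewrite !inE /pivot gA => /orP[/eqP->//|/hu].
have [[a aA aE] a0 am ha] := rotating_face fA gA.
move: (depth_le A); rewrite leq_eqVlt => /orP[/eqP dA|dl]; last first.
  have jm := mul_lt dl.
  left; apply/orP; right; apply/existsP; exists (Ordinal am) => /=; rewrite a0 /=.
  apply/forall_inP => x; rewrite !inE => /orP[/eqP->|/ha//].
  by rewrite val_pivot // /pivot_val modn_small; lia.
right; exists (first A); first by rewrite a0.
have pv := full_depth_pivot fA gA dA.
have [|[z zA zE] sp1] := spine fA gA (leqnn l).
  by move=> t tl; apply: window_before; rewrite dA.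
have sp0 t : (t <= l)%N -> exists2 x, x \in A & x = (first A + t * m)%N :> nat.
  rewrite leq_eqVlt => /orP[/eqP->|tl]; first by exists z.
  have [|//] := @spine A t fA gA (ltnW tl).
  by move=> j jt; apply: window_before; rewrite dA; lia.
have inA t (x : 'I_p.+1) : (t <= l)%N -> x = (first A + t * m)%N :> nat -> x \in A.
  by move=> /sp0[y yA yE] xE; rewrite (_ : x = y) //; apply: val_inj; rewrite /= xE yE.
have inA1 t (x : 'I_p.+1) : (t < l)%N -> x = (first A + t * m + 1)%N :> nat -> x \in A.
  by move=> /sp1[y yA yE] xE; rewrite (_ : x = y) //; apply: val_inj; rewrite /= xE yE.
apply/setP => x; rewrite !inE /rot_Delta; case: pv => [[h pE]|[e pE]].
  rewrite h inE; apply/orP/orP => [[/eqP->|xA]|].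
  - by right; rewrite pE -addnA addnCA modnMDl addn1 modn_small.
  - have [t [tl [->|[_ ->]]]] := full_depth_mem fA gA dA xA.
      by left; rewrite addnC modnMDl modn_small.
    by right; rewrite -addnA addnCA modnMDl addn1 modn_small.
  - have xE := divn_eq x m; have xl := div_le x; case=> /eqP xm; rewrite xm in xE.
      by right; apply: (@inA (x %/ m)%N) => //; lia.
    move: xl; rewrite leq_eqVlt => /orP[/eqP xd|xd].
      by left; rewrite -val_eqE /= pE xE xd; lia.
    by right; apply: (@inA1 (x %/ m)%N) => //; lia.
have -> : ((first A).+1 < m)%N = false by lia.
rewrite inE; apply/orP/orP => [[/eqP->|xA]|].
- by left; rewrite pE mod0n.
- have [t [tl [->|[_ ->]]]] := full_depth_mem fA gA dA xA.
    by right; rewrite addnC modnMDl modn_small // e.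
  left; rewrite (_ : (_ + _)%N = t.+1 * m)%N ?modnMl //.
  by rewrite e mulSn; lia.
- have xE := divn_eq x m; have xl := div_le x; case=> /eqP xm; rewrite xm in xE.
    case dE : (x %/ m)%N xl => [|t] tl.
      by left; rewrite -val_eqE /= pE xE dE.
    right; apply: (@inA1 t) => //; rewrite xE dE e mulSn; lia.
  by right; apply: (@inA (x %/ m)%N) => //; lia.
Qed.

Lemma rank_lt A B : ~~ has_gap A -> (first A < first B < p.+1)%N \/
    first A = first B /\ (depth A < depth B)%N -> (rank B < rank A)%N.
Proof.
move=> gA h; rewrite /rank (negPf gA); case: ifP => // _; rewrite ltnS.
have := depth_le A; have := depth_le B; move=> dB dA.
case: h => [h|[-> dAB]]; last by lia.
have : ((p.+1 - first B).+1 * l.+1 <= (p.+1 - first A) * l.+1)%N.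
  by rewrite leq_mul2r; lia.
by rewrite mulSn; lia.
Qed.

(** Acyclicity.  If the removal of [q] creates a gap away from 0, the rank drops
    to 0.  Otherwise the removal of the first vertex moves the first vertex up,
    and the removal of any other vertex keeps the pivot, unless it empties the
    window at the current depth, and then the depth grows. *)
Lemma pivot_facet A q (B := (pivot A |: A) :\ q) :
  face A -> pivot A \notin A -> q \in A ->
  face B /\ (pivot B \in B \/ (rank B < rank A)%N).
Proof.
move=> fA pA qA; have nqp : q != pivot A by apply: contraNneq pA => <-.
have pB : pivot A \in B by rewrite !inE eqxx eq_sym nqp.
case: (boolP (has_gap A)) => gA.
  have p0 : pivot A = ord0 by rewrite /pivot gA.
  have gB : has_gap B.
    apply: (@has_gapS _ (pivot A |: A)); first exact: subD1set.
    have /existsP[u /forall_inP hu] := gA; apply/existsP; exists u.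
    by apply/forall_inP => x; rewrite !inE p0 => /orP[/eqP->//|/hu].
  split; first by rewrite /face gB.
  by left; rewrite {1}/pivot gB -p0.
have [[a aA aE] a0 am ha] := rotating_face fA gA.
have pE := val_pivot gA.
have dl := depth_le A.
have fB : face B.
  have [fU|[a' a'm UE]] := matched_face fA pA.
    exact: faceS (subD1set _ _) fU.
  by rewrite /B UE; apply: rot_Delta_facet; [case/andP: a'm | rewrite -UE !inE qA orbT].
have BA x : x \in B -> x = pivot A \/ x \in A.
  by rewrite !inE => /andP[_ /orP[/eqP->|]]; [left|right].
have AB x : x \in A -> x != q -> x \in B by rewrite !inE orbC => -> ->.
have qB : q \notin B by rewrite !inE eqxx.
clearbody B; split=> //; case: (boolP (has_gap B)) => gB.
  by right; rewrite /rank gB (negPf gA).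
have [[b bB bE] b0 bm hb] := rotating_face fB gB.
have pval : pivot A = pivot_val A :> nat.
  move: pE (hb _ pB); case: (ltnP (pivot_val A) p.+1) => h.
    by rewrite modn_small.
  have -> : pivot_val A = p.+1.
    move: dl h; rewrite leq_eqVlt /pivot_val => /orP[/eqP->|/mul_lt];
      by move: am p_def; clear; lia.
  by rewrite modnn => -> /andP[]; rewrite leqNgt b0.
have pvA : (first A < pivot A)%N by rewrite pval /pivot_val addn1 ltnS leq_addr.
case: (eqVneq q a) => [qa|nqa].
  right; apply: rank_lt => //; left; rewrite bE ltn_ord andbT.
  have bq : b != q by apply: contraNneq qB => <-.
  case: (BA b bB) => [->//|/ha/andP[ab _]].
  by rewrite ltn_neqAle ab andbT aE eq_sym -qa.
have aB : a \in B by rewrite AB // eq_sym.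
have fE : first B = first A.
  rewrite aE; apply: first_eq => // x /BA[->|/ha]; last by rewrite aE => /andP[].
  by rewrite -aE ltnW.
have wS t : window B (first A) t -> window A (first A) t.
  case/exists_inP => x /BA[->|xA] xh; last exact: windowI xh.
  by have := window_avoid t pval; rewrite xh.
have dge : (depth A <= depth B)%N.
  apply: depth_ge => // t h; rewrite fE; apply: contra (@wS t) _.
  exact: window_before.
move: dge; rewrite leq_eqVlt => /orP[/eqP dE|h]; last first.
  by right; apply: rank_lt => //; right.
left; suff -> : pivot B = pivot A by [].
by rewrite /pivot (negPf gA) (negPf gB) /pivot_val fE dE.
Qed.

End Faces.

(** * Cocycles that count transversals *)

(** If deleting one entry of a sorted list leaves b, b+1, ..., b+r-1, then the
    deleted entry either duplicates one of these values, in which case two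
    consecutive deletions cancel, or is smaller than b. *)
Lemma sum_del_iota (w : seq nat) b r :
  sorted leq w -> all (fun x => x < b + r)%N w ->
  \sum_(i < size w) ((take i w ++ drop i.+1 w == iota b r)%:R * (-1) ^+ i : int)
  = (if w is x :: w' then (x < b)%N && (w' == iota b r) else false)%:R.
Proof.
elim: w b r => [|x w IH] b r; first by rewrite big_ord0.
rewrite /= path_sortedE; last exact: leq_trans.
move=> /andP[/allP xw sw] /andP[xb wb].
rewrite big_ord_recl /= drop0 expr0 mulr1.
under eq_bigr => i _ do rewrite exprS mulN1r mulrN.
case: r => [|r] in xb wb *.
  by rewrite addn0 in xb; rewrite xb /= big1 ?addr0 // => i _; rewrite mul0r oppr0.
rewrite /= sumrN.
under eq_bigr => i _ do rewrite eqseq_cons -mulnb natrM -mulrA.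
rewrite -mulr_sumr IH ?addSnnS //.
case: (ltngtP x b) => [_|bx|xE]; first by rewrite mul0r subr0.
  rewrite mul0r subr0; case: eqP => // wE.
  by have := xw b; rewrite wE mem_head leqNgt bx => /(_ isT).
case: w xw {IH sw wb} => [|y w] xw; first by rewrite mulr0 subr0.
have := xw y (mem_head _ _); rewrite mul1r /= eqseq_cons ltnS => xy.
by rewrite (_ : (y <= b)%N = (y == b)) ?subrr // eqn_leq -xE xy andbT.
Qed.

(** The simplices with increasing vertices form the standard basis of the group
    of chains; linear maps are computed on them. *)
Lemma sum_basis p (V : zmodType) (X : {set 'I_p} -> V) (B : {set 'I_p}) :
  \sum_A X A *~ osimplex (enum B) A = X B.
Proof.
have sB := sorted_enum B.
rewrite (bigD1 B) //= osimplex_sorted // eqxx mulr1z big1 ?addr0 // => A nA.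
rewrite osimplex_sorted //; case: eqP => // e; case/eqP: nA.
by apply/setP => x; rewrite -mem_enum e mem_enum.
Qed.

Lemma enum_set_sorted p (s : seq 'I_p) : sortedo s -> enum [set x in s] = s.
Proof. by move=> hs; apply: enum_sorted => // x; rewrite inE. Qed.

Lemma boundary_basis p (B : {set 'I_p}) : boundary (osimplex (enum B)) =
  \sum_(i < #|B|) osimplex (del (enum B) i) *~ (-1) ^+ i.
Proof. by rewrite /boundary sum_basis. Qed.

Lemma sum_osimplex p (P : pred (seq 'I_p)) s : sortedo s ->
  \sum_(A : {set 'I_p} | P (enum A)) osimplex s A = (P s)%:R.
Proof.
move=> /enum_set_sorted es; rewrite big_mkcond -{2}es.
rewrite -(sum_basis (fun A => (P (enum A))%:R : int)); apply: eq_bigr => A _.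
by rewrite es; case: (P _); rewrite ?mul0rz // -mulrzl mulr1 intz.
Qed.

(** Here [h] assigns to a vertex the number of its block; a simplex counts when
    it has one vertex in each of the blocks 1, ..., r. *)
Definition detect p (h : 'I_p -> nat) r (z : chain p) : int :=
  \sum_(A : {set 'I_p} | map h (enum A) == iota 1 r) z A.

Lemma detectB p (h : 'I_p -> nat) r z1 z2 :
  detect h r (z1 - z2) = detect h r z1 - detect h r z2.
Proof. by rewrite -sumrB; apply: eq_bigr => A _; rewrite !ffunE. Qed.

(** On the boundary of a single simplex the alternating sum of [sum_del_iota]
    appears; it is 1 if the simplex meets each of the blocks 0, ..., r once, and
    0 otherwise. *)
Lemma detect_boundary p (h : 'I_p -> nat) r e :
  (forall x y : 'I_p, (x < y)%N -> (h x <= h y)%N) ->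
  (forall x, h x < r.+1)%N ->
  detect h r (boundary e)
  = \sum_(B : {set 'I_p} | map h (enum B) == iota 0 r.+1) e B.
Proof.
move=> hmono hr; rewrite /detect.
under eq_bigr => A _.
  rewrite /boundary sum_ffunE.
  under eq_bigr => B _ do rewrite ffunMzE sum_ffunE mulr_suml.
  over.
rewrite exchange_big /= [RHS]big_mkcond; apply: eq_bigr => B _.
rewrite exchange_big /=.
have sB := sorted_enum B.
transitivity (e B * \sum_(i < #|B|)
    ((map h (del (enum B) i) == iota 1 r)%:R * (-1) ^+ i)).
  rewrite mulr_sumr; apply: eq_bigr => i _; rewrite -mulr_suml mulrC.
  congr (_ * _); rewrite -(@sum_osimplex _ (fun s => map h s == iota 1 r)).
    by rewrite mulr_suml; apply: eq_bigr => A _; rewrite ffunMzE.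
  exact: sorted_del.
have := @sum_del_iota (map h (enum B)) 1 r.
rewrite size_map -cardE => E.
under eq_bigr => i _ do rewrite /del map_cat map_take map_drop.
rewrite E => [|{E}|]; last first.
- by apply/allP => _ /mapP[x _ ->]; rewrite add1n.
- elim: (enum B) sB => // x s IH; rewrite sortedo_cons => /andP[/allP hx hs].
  rewrite /= path_sortedE; last exact: leq_trans.
  rewrite IH // andbT; apply/allP => _ /mapP[y ys ->].
  by apply: hmono; exact: hx.
case: (map h (enum B)) => [|x w]; first by rewrite mulr0.
by rewrite eqseq_cons ltnS leqn0; case: ifP => _; rewrite ?mulr1 ?mulr0.
Qed.

Section Blocks.

Variables (p m l : nat).
Hypotheses (m_gt1 : (1 < m)%N) (p_def : p.+1 = (l * m + m)%N).
Implicit Types A B : {set 'I_p.+1}.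

(** Each period of length m is cut after its first [s] vertices. *)
Definition block s (x : 'I_p.+1) : nat := (2 * (x %/ m) + (s <= x %% m)%N)%N.

Lemma block_lt s x : (block s x < (2 * l).+2)%N.
Proof. by rewrite /block; have := div_le m_gt1 p_def x; case: (s <= _)%N; lia. Qed.

Lemma block_mono s (x y : 'I_p.+1) : (x < y)%N -> (block s x <= block s y)%N.
Proof.
move=> xy; rewrite /block; have := leq_div2r m (ltnW xy).
rewrite leq_eqVlt => /orP[/eqP e|h]; last by case: (s <= _)%N; lia.
rewrite e leq_add2l; have := divn_eq x m; have := divn_eq y m; rewrite e => hy hx.
have : (x %% m <= y %% m)%N by lia.
by case: (leqP s (x %% m)) => // h1 h2; rewrite (leq_trans h1 h2).
Qed.

Lemma block_even s (x : 'I_p.+1) j : block s x = (2 * j)%N ->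
  (j * m <= x < j * m + s)%N.
Proof.
move=> h; have [h1 h2] : (x %/ m)%N = j /\ (x %% m < s)%N.
  by move: h; rewrite /block; case: (leqP s) => _; lia.
by have := divn_eq x m; rewrite h1; lia.
Qed.

Lemma block_odd s (x : 'I_p.+1) j : block s x = (2 * j).+1 ->
  (j * m + s <= x < j * m + m)%N.
Proof.
move=> h; have [h1 h2] : (x %/ m)%N = j /\ (s <= x %% m)%N.
  by move: h; rewrite /block; case: (leqP s) => _; lia.
have : (x %% m < m)%N by rewrite ltn_mod; lia.
by have := divn_eq x m; rewrite h1; lia.
Qed.

Definition transversal s A := map (block s) (enum A) == iota 0 (2 * l).+2.

(** Any m-1 consecutive vertices contain a whole block. *)
Lemma face_not_transversal s A : (0 < s < m)%N -> face m l A -> ~~ transversal s A.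
Proof.
move=> sm fA; apply/negP => /eqP tA.
have hit t : (t < (2 * l).+2)%N -> exists2 x, x \in A & block s x = t.
  move=> tl; have : t \in iota 0 (2 * l).+2 by rewrite mem_iota.
  by rewrite -tA => /mapP[x]; rewrite mem_enum => xA ->; exists x.
case/orP: fA => [/existsP[u /forall_inP hu]|/existsP[i /andP[i0 /forall_inP hi]]].
  have ul : (u <= l * m)%N by rewrite -ltnS.
  have uE := divn_eq u m; set j := (_ %/ m)%N in uE; set r := (_ %% m)%N in uE.
  have rm : (r < m)%N by rewrite ltn_mod; lia.
  have jl : (j <= l)%N.
    by rewrite -(@leq_pmul2r m); lia.
  case: (ltnP r s) => rs.
    have [|x xA /block_odd xj] := hit (2 * j).+1; first by lia.
    by have := hu x xA; lia.
  have jl' : (j < l)%N.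
    by rewrite ltn_neqAle jl andbT; apply: contraTneq ul => e; rewrite uE e; lia.
  have [|x xA /block_even] := hit (2 * j.+1)%N; first by lia.
  by rewrite mulSn; have := hu x xA; lia.
case: (ltnP i s) => hs.
  have [|x xA /block_odd xj] := hit (2 * l).+1; first by lia.
  by have := hi x xA; lia.
have [|x xA /(@block_even _ _ 0)] := hit 0%N; first by lia.
by have := hi x xA; lia.
Qed.

Definition pair_list c e : seq 'I_p.+1 :=
  flatten [seq [:: inord (i * m + c); inord (i * m + e)] | i <- iota 0 l.+1].

Lemma inord_small i c : (i <= l)%N -> (c < m)%N ->
  (inord (i * m + c) : 'I_p.+1) = (i * m + c)%N :> nat.
Proof.
move=> il cm; rewrite inordK //.
have : (i * m <= l * m)%N by rewrite leq_mul2r il orbT.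
by lia.
Qed.

Lemma pair_list_mem c e : (c < m)%N -> (e < m)%N -> pair_list c e =i pair_set p m c e.
Proof.
move=> cm em x; rewrite /pair_list [RHS]inE; apply/flatten_mapP/orP.
  move=> [i]; rewrite mem_iota add0n ltnS !inE => il /orP[/eqP->|/eqP->];
    rewrite inord_small // modnMDl modn_small //; by [left|right].
move=> h; exists (x %/ m)%N; first by rewrite mem_iota ltnS (div_le m_gt1 p_def).
rewrite !inE -!val_eqE /= !inord_small ?(div_le m_gt1 p_def) //; apply/orP.
by case: h => /eqP xm; [left|right]; rewrite {1}(divn_eq x m) xm.
Qed.

Lemma pair_list_sorted c e : (c < e < m)%N -> sortedo (pair_list c e).
Proof.
move=> ce; rewrite /pair_list.
have cm : (c < m)%N by lia.
have em : (e < m)%N by lia.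
have path_from L s (x : 'I_p.+1) : (s + L <= l.+1)%N -> (x < s * m + c)%N ->
    path (fun y z : 'I_p.+1 => (y < z)%N) x
      (flatten [seq [:: inord (i * m + c); inord (i * m + e)] | i <- iota s L]).
  elim: L s x => //= L IH s x sL xs; rewrite !inord_small ?xs //=; try lia.
  rewrite (_ : _ < _)%N /=; last by lia.
  by apply: IH; rewrite ?inord_small ?mulSn //; lia.
rewrite /= /sortedo /= (_ : (_ < _)%N) /=; last by rewrite !inord_small //; lia.
by apply: path_from; rewrite ?inord_small //; lia.
Qed.

Lemma enum_pair_set c e : (c < e < m)%N -> enum (pair_set p m c e) = pair_list c e.
Proof.
move=> ce; apply: enum_sorted; first exact: pair_list_sorted.
by apply: pair_list_mem; lia.
Qed.

Lemma transversal_pair_set s c e : (c < e < m)%N ->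
  transversal s (pair_set p m c e) = (c < s <= e)%N.
Proof.
move=> ce; rewrite /transversal enum_pair_set //.
have bE i k : (i <= l)%N -> (k < m)%N ->
    block s (inord (i * m + k)) = (2 * i + (s <= k)%N)%N.
  move=> il km; rewrite /block inord_small // modnMDl modn_small //.
  by rewrite divnMDl ?divn_small ?addn0 //; lia.
have cm : (c < m)%N by lia.
have em : (e < m)%N by lia.
case: (boolP (c < s <= e)%N) => h; last first.
  apply/negP => /eqP; rewrite /pair_list /= !bE // muln0 !add0n => -[h0 h1 _].
  by move: h0 h1 h; case: (leqP s c); case: (leqP s e); lia.
rewrite /pair_list (_ : (2 * l).+2 = (2 * l.+1)%N); last by lia.
have go L t : (t + L <= l.+1)%N ->
   [seq block s i | i <- flatten [seq [:: inord (i * m + c); inord (i * m + e)]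
      | i <- iota t L]] = iota (2 * t) (2 * L).
  elim: L t => [|L IH] t tL; first by rewrite muln0.
  have -> : (2 * L.+1 = (2 * L).+2)%N by lia.
  rewrite /= !bE ?IH //; try lia.
  have -> : (s <= c)%N = false by lia.
  have -> : (s <= e)%N = true by lia.
  have -> : (2 * t.+1 = (2 * t).+2)%N by lia.
  by rewrite addn0 addn1.
by rewrite go // muln0 eqxx.
Qed.

Lemma transversal_rot_Delta s a : (0 < s < m)%N -> (a < m)%N ->
  transversal s (rot_Delta p m a) = (a.+1 == s)%N || (a.+1 == m)%N.
Proof.
move=> sm am; rewrite /rot_Delta; case: ifP => h.
  by rewrite transversal_pair_set; lia.
by rewrite transversal_pair_set; lia.
Qed.

Lemma detect_block s (e : chain p.+1) :
  detect (block s) (2 * l).+1 (boundary e) = \sum_(B | transversal s B) e B.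
Proof.
by apply: detect_boundary; [exact: block_mono | exact: block_lt].
Qed.

End Blocks.

(** * Push-forward and rotation of ordered simplices *)

Lemma push_sum p q (f : 'I_p -> 'I_q) N (s : 'I_N -> seq 'I_p) (c : 'I_N -> int) :
  (forall j, sortedo (s j)) ->
  push f (\sum_(j < N) osimplex (s j) *~ c j)
  = \sum_(j < N) osimplex (map f (s j)) *~ c j.
Proof.
move=> hs; rewrite /push.
under eq_bigr => A _ do rewrite sum_ffunE mulrz_sumr.
rewrite exchange_big /=; apply: eq_bigr => j _.
rewrite -{2}(enum_set_sorted (hs j)).
rewrite -(sum_basis (fun A => osimplex (map f (enum A)))) mulrz_suml.
by apply: eq_bigr => A _; rewrite enum_set_sorted // ffunMzE mulrzA.
Qed.

Lemma sum_pairs (V : zmodType) (f : nat -> V) L :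
  \sum_(j < 2 * L) f j = \sum_(i < L) (f (2 * i)%N + f (2 * i).+1).
Proof.
elim: L => [|L IH]; first by rewrite muln0 !big_ord0.
have -> : (2 * L.+1 = (2 * L).+2)%N by lia.
by rewrite !big_ord_recr /= IH addrA.
Qed.

(** Deleting the vertices of a list of pairs one by one with alternating signs:
    this brings the definition of the boundary of Delta to the usual form. *)
Lemma sum_rem_pairs p (V : zmodType) (H : seq 'I_p -> V) (F G : nat -> 'I_p) L
    (s := flatten [seq [:: F i; G i] | i <- iota 0 L]) : uniq s ->
  \sum_(i < L) (H (rem (F i) s) - H (rem (G i) s))
  = \sum_(j < 2 * L) H (del s j) *~ (-1) ^+ j.
Proof.
move=> us; rewrite (sum_pairs (fun j => H (del s j) *~ (-1) ^+ j)); apply: eq_bigr => i _.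
have nthE K t j x0 : (j < K)%N ->
    let w := flatten [seq [:: F i; G i] | i <- iota t K] in
    nth x0 w (2 * j) = F (t + j)%N /\ nth x0 w (2 * j).+1 = G (t + j)%N.
  elim: K t j => // K IH t [|j] jK; first by rewrite addn0.
  have -> : (2 * j.+1 = (2 * j).+2)%N by lia.
  by have := IH t.+1 j jK; rewrite addSnnS.
have sizeE K t : size (flatten [seq [:: F i; G i] | i <- iota t K]) = (2 * K)%N.
  by elim: K t => //= K IH t; rewrite IH; lia.
have [nF nG] := nthE L 0%N i (F i) (ltn_ord i).
have iL := ltn_ord i.
have iF : index (F i) s = (2 * i)%N.
  by rewrite -[F i in LHS]nF index_uniq // sizeE; lia.
have iG : index (G i) s = (2 * i).+1.
  by rewrite -[G i in LHS]nG index_uniq // sizeE; lia.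
rewrite -!del_index iF iG exprS mulN1r mulrNz.
by rewrite exprM sqrrN !expr1n mulr1z.
Qed.

(** Moving the smallest vertex from the end to the front passes over all the
    other vertices. *)
Lemma osimplex_rcons p (s : seq 'I_p) (x : 'I_p) : all (fun y : 'I_p => (x < y)%N) s ->
  osimplex (rcons s x) = osimplex (x :: s) *~ (-1) ^+ size s.
Proof.
move=> hx; apply/ffunP => A; rewrite ffunMzE !ffunE rcons_uniq /=.
have -> : [set y in rcons s x] = [set y in x :: s].
  by apply/setP => y; rewrite !inE mem_rcons inE.
case: ifP => _; last by rewrite mul0r.
rewrite -exprD; congr (_ ^+ _).
have -> : count (fun y : 'I_p => (y < x)%N) s = 0%N.
  apply/eqP; rewrite -leqn0 leqNgt -has_count; apply/hasPn => y /(allP hx).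
  by rewrite -leqNgt => /ltnW.
rewrite add0n; elim: s hx => //= y s IH /andP[xy xs].
by rewrite IH // -cats1 count_cat /= xy; lia.
Qed.

(** The sign of a cyclic shift of an even number of vertices, observed on the
    boundary. *)
Lemma boundary_rot p (s : seq 'I_p) (x : 'I_p) : all (fun y : 'I_p => (x < y)%N) s ->
  odd (size s) ->
  \sum_(i < (size s).+1) osimplex (del (rcons s x) i) *~ (-1) ^+ i
  = - \sum_(i < (size s).+1) osimplex (del (x :: s) i) *~ (-1) ^+ i.
Proof.
move=> hx os; rewrite big_ord_recr [in RHS]big_ord_recl /= opprD addrC.
congr (_ + _).
  rewrite /del -cats1 takel_cat // take_size drop_oversize ?size_cat ?addn1 // cats0.
  by rewrite -signr_odd os expr1 mulrNz expr0 /= drop0.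
rewrite -sumrN; apply: eq_bigr => i _; have iS := ltn_ord i.
have dE : del (rcons s x) i = rcons (del s i) x.
  by rewrite /del drop_rcons // -cats1 takel_cat ?(ltnW iS) // rcons_cat.
have -> : del (x :: s) (bump 0 i) = x :: del s i by [].
rewrite dE osimplex_rcons; last first.
  by apply/allP => y /(mem_subseq (del_subseq s i)) /(allP hx).
rewrite -mulrzA -mulrNz -exprD; congr (_ *~ _).
have -> : size (del s i) = (size s).-1.
  by rewrite size_cat size_take size_drop iS; lia.
have even_pred : odd (size s).-1 = false by case: (size s) os => //= N /negPf.
rewrite /bump leq0n exprS mulN1r opprK exprD -[X in X * _]signr_odd even_pred.
by rewrite expr0 mul1r.
Qed.

(** * The complex on Z/n and the rotated cycles *)

Section Cyclic.

Variables (n m l : nat).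
Hypotheses (m_gt1 : (1 < m)%N) (n_def : n = (l * m + m)%N).

Lemma n_gt1 : (1 < n)%N. Proof. by rewrite n_def; lia. Qed.

Lemma Zn_def : (Zp_trunc n).+2 = (l * m + m)%N.
Proof. by rewrite Zp_cast ?n_gt1. Qed.

Lemma natr_Zn a : (a < n)%N -> (a%:R : 'Z_n) = inord a.
Proof.
move=> an; apply: val_inj; rewrite /= val_Zp_nat ?n_gt1 // modn_small //.
by rewrite inordK // Zp_cast ?n_gt1.
Qed.

Lemma val_natr a : ((a%:R : 'Z_n) : nat) = (a %% n)%N.
Proof. exact: val_Zp_nat n_gt1 _. Qed.

(** The arcs starting at [i >= m] wrap around and are described by the vertices
    that they miss. *)
Lemma arcP i (x : 'Z_n) : (i < n)%N ->
  reflect (if (i < m)%N then (i <= x <= i + l * m)%N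
           else (x <= i - m)%N || (i <= x)%N) (x \in Defs.arc n i (i + l * m)).
Proof.
move=> i_n; have xn : (x < n)%N by have := ltn_ord x; rewrite {2}Zp_cast ?n_gt1.
rewrite inE; apply: (iffP mapP) => [[a]|].
  rewrite mem_index_iota ltnS => ai xE.
  have {}xE : x = (a %% n)%N :> nat by rewrite xE val_natr.
  case: (ltnP a n) => an.
    by rewrite modn_small // in xE; case: ifP; lia.
  have aE : x = (a - n)%N :> nat.
    by rewrite xE -{1}(subnK an) modnDr modn_small //; lia.
  by case: ifP; lia.
case: (ltnP x i) => xi h; last first.
  by exists (x : nat); rewrite ?natr_Zp // mem_index_iota; move: h; case: ifP; lia.
exists (x + n)%N; first by rewrite mem_index_iota; move: h; case: ifP; lia.
by apply: val_inj; rewrite /= val_natr modnDr modn_small.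
Qed.

Lemma NN_face (A : {set 'Z_n}) : (A \in NN n (l * m)) = face m l A.
Proof.
rewrite inE; apply/existsP/orP => [[i sA]|].
  have iA x : x \in A -> if (i < m)%N then (i <= x <= i + l * m)%N
           else (x <= i - m)%N || (i <= x)%N.
    by move=> /(subsetP sA) /arcP; apply.
  case: (ltnP i m) iA => im iA.
    case: (posnP i) => i0.
      left; apply: (@has_gapI _ _ _ _ (l * m)) => // x /iA; rewrite i0; lia.
    by right; apply/existsP; exists (Ordinal im); rewrite /= i0; apply/forall_inP.
  left; apply: (@has_gapI _ _ _ _ (i - m)).
    by have := ltn_ord i; lia.
  by move=> x /iA; rewrite subnK.
case=> [/existsP[u /forall_inP hu]|/existsP[i /andP[i0 /forall_inP hi]]]; last first.
  have im := ltn_ord i; have i_n : (i < n)%N by lia.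
  exists (Ordinal i_n); apply/subsetP => x /hi hx.
  by apply/arcP => //=; rewrite im.
have ul : (u <= l * m)%N by rewrite -ltnS.
have n0 : (0 < n)%N by have := n_gt1; lia.
have xn (x : 'Z_n) : (x < n)%N by have := ltn_ord x; rewrite {2}Zp_cast ?n_gt1.
move: ul; rewrite leq_eqVlt => /orP[/eqP uE|ul].
  (* The missed vertices are the last m-1 ones, and the arc starts at 0. *)
  exists (Ordinal n0); apply/subsetP => x /hu; rewrite uE => hx.
  by apply/arcP => //=; rewrite (ltnW m_gt1); have := xn x; lia.
have i_n : (u + m < n)%N by lia.
(* The arc starts just above the gap and wraps around. *)
exists (Ordinal i_n); apply/subsetP => x /hu hx; apply/arcP => //=.
by rewrite ltnNge leq_addl /= addnK.
Qed.

Lemma iter_g a (x : 'Z_n) : iter a (@g n) x = x + a%:R.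
Proof. by elim: a => [|a IH]; rewrite ?addr0 // iterS IH /g -addrA -natr1. Qed.

Lemma DeltaE : Delta n (l * m) l =
  flatten [seq [:: ((i * m)%N%:R : 'Z_n); (i * m + 1)%N%:R] | i <- iota 0 l.+1].
Proof. by rewrite /Delta n_def addnC addnK. Qed.

Lemma pair_listE c e : (c < m)%N -> (e < m)%N ->
  flatten [seq [:: ((i * m + c)%N%:R : 'Z_n); (i * m + e)%N%:R] | i <- iota 0 l.+1]
  = pair_list (Zp_trunc n).+1 m l c e.
Proof.
move=> cm em; congr flatten; apply/eq_in_map => i.
rewrite mem_iota add0n ltnS => /andP[_ il].
have : (i * m <= l * m)%N by rewrite leq_mul2r il orbT.
by move=> im; rewrite !natr_Zn //; lia.
Qed.

Lemma Delta_pair_list : Delta n (l * m) l = pair_list (Zp_trunc n).+1 m l 0 1.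
Proof.
rewrite DeltaE -pair_listE //; last exact: ltnW.
by congr flatten; apply/eq_map => i; rewrite addn0.
Qed.

Lemma sorted_Delta : sortedo (Delta n (l * m) l).
Proof. by rewrite Delta_pair_list; apply: pair_list_sorted m_gt1 Zn_def _ _ _. Qed.

Lemma bdDeltaE : bdDelta n (l * m) l =
  \sum_(j < 2 * l.+1) osimplex (del (Delta n (l * m) l) j) *~ (-1) ^+ j.
Proof.
have us := sortedo_uniq sorted_Delta.
rewrite /bdDelta; move: us; rewrite DeltaE n_def addnC addnK => us.
exact: (@sum_rem_pairs _ _ (@osimplex _) _ _ _ us).
Qed.

Lemma map_del (f : 'Z_n -> 'Z_n) s j : map f (del s j) = del (map f s) j.
Proof. by rewrite /del map_cat map_take map_drop. Qed.

Lemma push_bdDelta a : push (iter a (@g n)) (bdDelta n (l * m) l)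
  = \sum_(j < 2 * l.+1)
      osimplex (del (map (iter a (@g n)) (Delta n (l * m) l)) j) *~ (-1) ^+ j.
Proof.
rewrite bdDeltaE push_sum => [|j]; last exact: sorted_del sorted_Delta.
by apply: eq_bigr => j _; rewrite map_del.
Qed.

Lemma map_iter_Delta a : map (iter a (@g n)) (Delta n (l * m) l) =
  flatten [seq [:: ((i * m + a)%N%:R : 'Z_n); (i * m + a.+1)%N%:R] | i <- iota 0 l.+1].
Proof.
rewrite DeltaE map_flatten -map_comp; congr flatten; apply/eq_map => i /=.
by rewrite !iter_g -!natrD addnAC addn1 addnS.
Qed.

Lemma card_pair_set c e : (c < e < m)%N ->
  #|pair_set (Zp_trunc n).+1 m c e| = (2 * l.+1)%N.
Proof.
move=> ce; rewrite cardE (enum_pair_set m_gt1 Zn_def) // /pair_list.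
have size_from L t : size (flatten [seq [:: inord (i * m + c); inord (i * m + e)]
    | i <- iota t L] : seq 'Z_n) = (2 * L)%N.
  by elim: L t => // L IH t; rewrite /= IH; lia.
exact: size_from.
Qed.

(** For a < m-1 the rotated list of vertices of Delta is still increasing; for
    a = m-1 its last vertex becomes 0 and the list is a cyclic shift of the
    increasing one. *)
Lemma push_bdDelta_rot_Delta a : (a < m)%N ->
  push (iter a (@g n)) (bdDelta n (l * m) l)
  = boundary (osimplex (enum (rot_Delta (Zp_trunc n).+1 m a)))
      *~ (if (a.+1 < m)%N then 1 else -1).
Proof.
move=> am; rewrite push_bdDelta map_iter_Delta boundary_basis /rot_Delta.
case: ifP => ha.
  by rewrite card_pair_set ?ltnSn // (enum_pair_set m_gt1 Zn_def) ?ltnSn // pair_listE.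
have aE : a = m.-1 by lia.
have lt0 : (0 < m.-1 < m)%N by lia.
rewrite card_pair_set // (enum_pair_set m_gt1 Zn_def) // mulrNz mulr1z.
have rotE L t : (t * m)%N%:R :: flatten
    [seq [:: ((i * m + a)%N%:R : 'Z_n); (i * m + a.+1)%N%:R] | i <- iota t L]
  = rcons (flatten [seq [:: ((i * m + 0)%N%:R : 'Z_n); (i * m + m.-1)%N%:R]
      | i <- iota t L]) ((t + L) * m)%N%:R.
  elim: L t => [|L IH] t; first by rewrite addn0.
  rewrite /= addn0 -aE; congr [:: _, _ & _].
  have -> : (t * m + a.+1 = t.+1 * m)%N by rewrite mulSn; lia.
  by rewrite IH addSnnS -aE.
(* The last vertex is n, that is 0 in Z/n. *)
have := rotE l.+1 0%N; rewrite (@pair_listE 0 m.-1) //; try lia.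
set T := flatten _.
have := pair_list_sorted m_gt1 Zn_def lt0.
have := congr1 size (enum_pair_set m_gt1 Zn_def lt0).
rewrite -cardE card_pair_set //.
have -> : pair_list (Zp_trunc n).+1 m l 0 m.-1
  = inord 0 :: behead (pair_list (Zp_trunc n).+1 m l 0 m.-1) by [].
set S := behead _; rewrite sortedo_cons => sS /andP[hS _].
have {}sS : (2 * l.+1 = (size S).+1)%N := sS.
have x0 : inord 0 = (0%:R : 'Z_n) by rewrite natr_Zn //; have := n_gt1; lia.
have -> : ((0 + l.+1) * m)%N%:R = (0%:R : 'Z_n).
  by apply: val_inj; rewrite /= !val_natr add0n mulSn addnC -n_def modnn.
rewrite mul0n -x0 => /(congr1 behead) TE.
have {}TE : T = rcons S (inord 0) := TE.
rewrite TE sS.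
by apply: boundary_rot => //; have := sS; lia.
Qed.

End Cyclic.

(** * The homology group *)

Section Homology.

Local Open Scope quotient_scope.

Variables (n m l : nat).
Hypotheses (m_gt1 : (1 < m)%N) (n_def : n = (l * m + m)%N).

Local Notation K := (NN n (l * m)).
Local Notation d := (2 * l)%N.
Local Notation D a := (rot_Delta (Zp_trunc n).+1 m a).
Local Notation simplex B := (osimplex (enum B)).
Local Notation detect_at s := (detect (@block (Zp_trunc n).+1 m s) d.+1).

Let p_def := Zn_def m_gt1 n_def.

Lemma card_rot_Delta a : (a < m)%N -> #|D a| = (2 * l.+1)%N.
Proof.
move=> am; rewrite /rot_Delta.
by case: ifP => ?; rewrite (card_pair_set m_gt1 n_def); lia.
Qed.

Lemma detect_rot_Delta s a : (0 < s < m)%N -> (a < m)%N ->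
  detect_at s (boundary (simplex (D a))) = ((a.+1 == s) || (a.+1 == m))%:R.
Proof.
move=> sm am; rewrite (detect_block m_gt1 p_def).
rewrite (sum_osimplex (fun w => map (block m s) w == iota 0 d.+2)); last first.
  exact: sorted_enum.
by rewrite -(transversal_rot_Delta m_gt1 p_def sm am).
Qed.

Lemma detect_face s e : (0 < s < m)%N -> is_chain K d.+1 e ->
  detect_at s (boundary e) = 0.
Proof.
move=> sm /is_chainP eN; rewrite (detect_block m_gt1 p_def).
apply: big1 => B tB; apply: eN; rewrite (NN_face m_gt1 n_def).
by apply/negP => /andP[fB _]; have := face_not_transversal m_gt1 p_def sm fB; rewrite tB.
Qed.

Lemma rot_Delta_cycle a : (a < m)%N -> boundary (simplex (D a)) \in is_cycle K d.
Proof.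
move=> am; rewrite unfold_in boundary_boundary eqxx andbT; apply/is_chainP => A.
rewrite boundary_basis boundary_basisE; apply: contraNeq => /sum_neq0[v vD].
rewrite mulf_eq0 negb_or => /andP[].
case: (A =P _ :\ _) => [-> _ _|_]; last by rewrite eqxx.
rewrite (NN_face m_gt1 n_def) (rot_Delta_facet m_gt1 p_def) //=.
have := cardsD1 v (D a); rewrite vD card_rot_Delta // mulnS add2n add1n => /eqP.
by rewrite eqSS eq_sym.
Qed.

(** The filling chain provided by the matching may have coefficients at the sets
    [rot_Delta a], 0 < a < m.  The cocycle for s = 1 sees only a = m-1, and the one
    for s = a+1 sees only a and m-1. *)
Lemma detect_inj z : is_chain K d z -> boundary z = 0 ->
  (forall s, (0 < s < m)%N -> detect_at s z = 0) ->
  exists2 e, is_chain K d.+1 e & z = boundary e.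
Proof.
move=> zN bz z0.
have KE A : (A \in K) = face m l A := NN_face m_gt1 n_def A.
have [A AK|L q LK|e eP zE] := @matching_fill _ d K (pivot m l) (rank m l) _ _ z zN bz.
- by rewrite KE => pA; apply: (pivot_del m_gt1 p_def); rewrite -?KE.
- by rewrite !KE in LK *; exact: (pivot_facet m_gt1 p_def).
have eD B : e B != 0 -> ~~ face m l B -> exists2 a, (0 < a < m)%N & B = D a.
  move=> /eP[L [LK pL _ ->]] /negP nB; rewrite KE in LK.
  by case: (matched_face m_gt1 p_def LK pL).
have sum0 s : (0 < s < m)%N -> \sum_(B | transversal m l s B) e B = 0.
  by move=> sm; rewrite -(detect_block m_gt1 p_def) -zE z0.
have eT s B : (0 < s < m)%N -> transversal m l s B -> e B != 0 ->
    exists2 a, [&& (0 < a)%N, (a < m)%N & (a.+1 == s) || (a.+1 == m)] & B = D a.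
  move=> sm tB eB.
  have nB : ~~ face m l B.
    apply/negP => fB.
    by have := face_not_transversal m_gt1 p_def sm fB; rewrite tB.
  have [a /andP[a0 am] BE] := eD B eB nB; exists a => //.
  by rewrite a0 am -(transversal_rot_Delta m_gt1 p_def sm am) -BE.
have tD s a : (0 < s < m)%N -> (a < m)%N -> (a.+1 == s) || (a.+1 == m) ->
    transversal m l s (D a).
  by move=> sm am h; rewrite (transversal_rot_Delta m_gt1 p_def sm am).
have lastD : e (D m.-1) = 0.
  have := sum0 1%N; rewrite (bigD1 (D m.-1)) /=; last by apply: tD; lia.
  rewrite big1 ?addr0 => [->//|B /andP[tB nB]].
  apply/eqP/negbNE/negP => eB; have [a ha BE] := eT 1%N B m_gt1 tB eB.
  by move: nB; rewrite BE (_ : a = m.-1) ?eqxx //; lia.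
have allD a : (0 < a < m)%N -> e (D a) = 0.
  move=> am; case: (eqVneq a m.-1) => [->//|na].
  have sm : (0 < a.+1 < m)%N by lia.
  have := sum0 a.+1 sm; rewrite (bigD1 (D a)) /=; last by apply: tD; lia.
  rewrite big1 ?addr0 // => B /andP[tB nB].
  apply/eqP/negbNE/negP => eB; have [b hb BE] := eT a.+1 B sm tB eB.
  have nb : b != a by apply: contraNneq nB => <-; rewrite BE.
  by move: eB; rewrite BE (_ : b = m.-1) ?lastD ?eqxx //; lia.
exists e => //; apply/is_chainP => B; apply: contraNeq => eB; apply/andP; split.
  rewrite KE; apply/negbNE/negP => nB.
  by have [a am BE] := eD B eB nB; rewrite BE allD ?eqxx in eB.
by have [L [_ pL cL ->]] := eP B eB; rewrite cardsU1 pL cL.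
Qed.

Local Notation cls z := (\pi_(Quotient.quot (@is_boundary _ K d)) z).

Definition coords (x : homology K d) : 'rV[int]_m.-1 :=
  \row_i detect_at i.+1 (val (repr x)).

(** The coordinates do not depend on the representative, as the cocycles vanish
    on boundaries of chains of faces. *)
Lemma coords_cls (z : cycles K d) :
  coords (cls z) = \row_i detect_at i.+1 (val z).
Proof.
apply/rowP => i; rewrite !mxE; apply/eqP; rewrite -subr_eq0 -detectB.
have : repr (cls z) - z \in @is_boundary _ K d.
  by rewrite Quotient.idealrBE reprK.
rewrite unfold_in => /asboolP[e eN]; rewrite raddfB => ->.
by rewrite detect_face //; have := ltn_ord i; lia.
Qed.

Lemma coordsB : {morph coords : x y / x - y}.
Proof.
move=> x y; rewrite -[x]reprK -[y]reprK -raddfB !coords_cls.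
by apply/rowP => i; rewrite !mxE raddfB detectB.
Qed.

Lemma coords_inj : injective coords.
Proof.
move=> x y exy; apply/eqP; rewrite -subr_eq0; apply/eqP.
have := coordsB x y; rewrite exy subrr; move: (x - y) => {exy y}{}x x0.
have [zN bz] := andP (valP (repr x)).
have [s sm|e eN zE] := detect_inj zN (eqP bz).
  have sm' : (s.-1 < m.-1)%N by lia.
  have := congr1 (fun v : 'rV_m.-1 => v ord0 (Ordinal sm')) x0.
  by rewrite !mxE /= prednK //; lia.
rewrite -[x]reprK -[RHS](raddf0 (\pi_(Quotient.quot (@is_boundary _ K d)))).
apply/eqP; rewrite -Quotient.idealrBE subr0 unfold_in.
by apply/asboolP; exists e.
Qed.

Lemma coords_alpha a : (a < m)%N -> coords (alpha n (l * m) l a) =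
  \row_i (if (a.+1 < m)%N then (i == a :> nat)%:R else -1).
Proof.
move=> am; rewrite /alpha /hclass coords_cls.
have cD := rot_Delta_cycle am.
rewrite (push_bdDelta_rot_Delta m_gt1 n_def am) insubdK; last first.
  by case: ifP => _; rewrite ?mulrNz mulr1z ?rpredN.
have detectN s (c : chain (Zp_trunc n).+2) : detect_at s (- c) = - detect_at s c.
  by rewrite -sub0r detectB /detect big1 ?sub0r // => A _; rewrite ffunE.
apply/rowP => i; rewrite !mxE; have im := ltn_ord i.
case: ifP => ha; rewrite ?mulrNz mulr1z ?detectN detect_rot_Delta //; try lia.
Qed.

Lemma homology_basis : [/\ is_Zbasis (fun i : 'I_m.-1 => alpha n (l * m) l i),
      (exists phi : {additive homology K d -> 'rV[int]_m.-1}, bijective phi)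
    & \sum_(i < m) alpha n (l * m) l i = 0].
Proof.
pose coordsM := GRing.isZmodMorphism.Build _ _ coords coordsB.
have [phi phiE] : exists phi : {additive homology K d -> 'rV[int]_m.-1},
    phi =1 coords.
  pose phi : {additive homology K d -> 'rV[int]_m.-1} := HB.pack coords coordsM.
  by exists phi.
have phi_inj : injective phi by apply: eq_inj coords_inj _ => x; rewrite phiE.
have phi_alpha (i : 'I_m.-1) : phi (alpha n (l * m) l i) = delta_mx 0 i.
  have im := ltn_ord i.
  rewrite phiE coords_alpha; last by lia.
  apply/rowP => j; rewrite !mxE eqxx /=.
  by have -> : (i.+1 < m)%N by lia.
(* Since [coords] is injective, mapping back the standard basis inverts it. *)
pose psi (v : 'rV[int]_m.-1) := \sum_(i < m.-1) alpha n (l * m) l i *~ v 0 i.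
have psiK v : phi (psi v) = v.
  rewrite raddf_sum; apply/rowP => j; rewrite summxE (bigD1 j) //= big1 ?addr0.
    by rewrite raddfMz phi_alpha -scaler_int !mxE !eqxx mulr1 intz.
  move=> i nij; rewrite raddfMz phi_alpha -scaler_int !mxE eqxx /= eq_sym.
  by rewrite (negPf nij) mulr0.
split.
- move=> x; exists [ffun i => phi x 0 i]; split.
    apply: phi_inj; rewrite -[LHS]psiK; congr (phi _).
    by apply: eq_bigr => i _; rewrite ffunE.
  move=> a xE; apply/ffunP => i; rewrite ffunE xE.
  have -> : \sum_(i < m.-1) alpha n (l * m) l i *~ a i = psi (\row_j a j).
    by apply: eq_bigr => j _; rewrite mxE.
  by rewrite psiK mxE.
- exists phi; exists psi => [x|]; last exact: psiK.
  by apply: phi_inj; rewrite psiK.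
apply: phi_inj; rewrite raddf0 raddf_sum /=.
(* In each coordinate one basis vector contributes 1 and alpha_(m-1) gives -1. *)
apply/rowP => j; have jm := ltn_ord j; rewrite summxE mxE.
have jm' : (j < m)%N by lia.
have lm : (m.-1 < m)%N by lia.
rewrite (bigD1 (Ordinal lm)) // (bigD1 (Ordinal jm')) /=; last first.
  by rewrite -val_eqE /=; lia.
rewrite big1 => [|i /andP[il ij]].
  rewrite !phiE !coords_alpha // !mxE /= eqxx prednK ?ltnn; last by lia.
  by have -> : (j.+1 < m)%N by lia; rewrite addr0 addNr.
have im := ltn_ord i; rewrite -val_eqE /= in il; rewrite -val_eqE /= in ij.
rewrite phiE coords_alpha // mxE eq_sym (negPf ij).
by have -> : (i.+1 < m)%N by lia.
Qed.

End Homology.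

Theorem proposition6p1 (n k l : nat) (hk : (k + 2 <= n)%N)
    (hkl : k%:R / n%:R = l%:R / (l + 1)%:R :> rat) :
  [/\ is_Zbasis (fun i : 'I_(n - k - 1) => alpha n k l i),
      (exists phi : {additive homology (NN n k) (2 * l) -> 'rV[int]_(n - k - 1)},
         bijective phi)
    & \sum_(i < n - k) alpha n k l i = 0].
Proof.
have kE : k = (l * (n - k))%N.
  move/eqP: hkl.
  rewrite eqr_div ?Num.Theory.pnatr_eq0 -?natrM ?Num.Theory.eqr_nat; try lia.
have [m mE] : {m | n - k = m}%N by exists (n - k)%N.
rewrite mE in kE *; rewrite subn1 kE.
by apply: homology_basis; rewrite -?kE; lia.
Qed.
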